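(* Let $P=P(A,b)=\{x\in\mathbb{R}^n: Ax\le b\}$ be a full-dimensional polytope given by an irredundant system of inequalities, let $F$ be a nonempty face of $P$, and let $I=\mathrm{eq}\,F$ be the index set of the inequalities that are tight at $F$. Let $0\le d\le n$, let $\pi_d:\mathbb{R}^{n-d}\times\mathbb{R}^d\to\mathbb{R}^d$ be the projection to the last $d$ coordinates, and write $A=(\overline A\,|\,\overline{\overline A})$, where $\overline A$ consists of the first $n-d$ columns of $A$ and $\overline{\overline A}$ of the last $d$ columns. Then $F$ is strictly preserved by $\pi_d:P\to\mathbb{R}^d$ if and only if the rows of $\overline A_I$ are positively spanning.
   Context: For an index set $I$, $\overline A_I$ is the submatrix of $\overline A$ formed by the rows indexed by $I$. $\mathrm{eq}\,F$ is the set of indices $i$ such that $a_i^{\mathsf T}x=b_i$ for all $x\in F$, where $a_i^{\mathsf T}$ is the $i$-th row of $A$. A nonempty face $F$ of $P$ is strictly preserved by an affine projection $\pi:P\to\mathbb{R}^d$ if (i) $\pi(F)$ is a face of $\pi(P)$ combinatorially equivalent to $F$, and (ii) $\pi^{-1}(\pi(F))=F$ (preimage in $P$). (Both $P$ and $\pi(P)$ count as faces of themselves.) A finite collection of vectors $g_1,\dots,g_m\in\mathbb{R}^k$ is positively dependent if there are $\lambda_1,\dots,\lambda_m>0$ with $\lambda_1g_1+\dots+\lambda_mg_m=0$; it is positively spanning if in addition it has full rank $k$. *)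

(* Defs.v *)
From mathcomp Require Export all_boot all_order all_algebra.
From mathcomp Require Export all_classical all_reals all_analysis.
Export Order.TTheory GRing.Theory Num.Theory.
Export numFieldNormedType.Exports.

Set Implicit Arguments.
Unset Strict Implicit.
Unset Printing Implicit Defensive.

Local Open Scope classical_set_scope.
Local Open Scope ring_scope.

Definition polyhedron (R : realType) (m n : nat)
    (A : 'M[R]_(m, n)) (b : 'cV[R]_m) : set 'cV[R]_n :=
  [set x | forall i, (A *m x) i 0 <= b i 0].

Definition irredundant (R : realType) (m n : nat)
    (A : 'M[R]_(m, n)) (b : 'cV[R]_m) : Prop :=
  forall i, polyhedron (row' i A) (row' i b) <> polyhedron A b.

Definition affine_hull (R : realType) (n : nat) (S : set 'cV[R]_n) :
    set 'cV[R]_n :=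
  [set x | exists (k : nat) (p : 'I_k -> 'cV[R]_n) (l : 'I_k -> R),
     [/\ forall i, S (p i), \sum_i l i = 1 & x = \sum_i l i *: p i]].

Definition full_dimensional (R : realType) (n : nat) (S : set 'cV[R]_n) : Prop :=
  affine_hull S = setT.

(* A face is cut out by a valid inequality [c x <= c0]. With [c = 0] this
   yields both [P] itself ([c0 = 0]) and the empty face ([c0 = 1]). *)
Definition is_face (R : realType) (n : nat) (P F : set 'cV[R]_n) : Prop :=
  exists (c : 'rV[R]_n) (c0 : R),
    (forall x, P x -> (c *m x) 0 0 <= c0) /\
    F = P `&` [set x | (c *m x) 0 0 = c0].

(* Isomorphism of the face lattices: [f] and [g] are mutually inverse on faces
   and [f] preserves and reflects inclusion. *)
Definition comb_equivalent (R : realType) (n d : nat)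
    (P : set 'cV[R]_n) (Q : set 'cV[R]_d) : Prop :=
  exists (f : set 'cV[R]_n -> set 'cV[R]_d) (g : set 'cV[R]_d -> set 'cV[R]_n),
    [/\ forall F, is_face P F -> is_face Q (f F) /\ g (f F) = F,
        forall G, is_face Q G -> is_face P (g G) /\ f (g G) = G &
        forall F F', is_face P F -> is_face P F' ->
          (f F `<=` f F' <-> F `<=` F')].

Definition strictly_preserved (R : realType) (n d : nat)
    (pi : 'cV[R]_n -> 'cV[R]_d) (P F : set 'cV[R]_n) : Prop :=
  [/\ is_face (pi @` P) (pi @` F),
      comb_equivalent (pi @` F) F &
      P `&` pi @^-1` (pi @` F) = F].

Definition eq_set (R : realType) (m n : nat)
    (A : 'M[R]_(m, n)) (b : 'cV[R]_m) (F : set 'cV[R]_n) : {set 'I_m} :=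
  [set i | `[< forall x, F x -> (A *m x) i 0 = b i 0 >]]%SET.

Definition row_submx (R : realType) (m n : nat)
    (A : 'M[R]_(m, n)) (I : {set 'I_m}) : 'M[R]_(#|I|, n) :=
  rowsub (fun j : 'I_#|I| => enum_val j) A.

(* The vectors [g_1, ..., g_m] are the rows of [G]. *)
Definition positively_dependent (R : realType) (m k : nat)
    (G : 'M[R]_(m, k)) : Prop :=
  exists l : 'I_m -> R,
    (forall i, 0 < l i) /\ \sum_i l i *: row i G = 0.

Definition positively_spanning (R : realType) (m k : nat)
    (G : 'M[R]_(m, k)) : Prop :=
  positively_dependent G /\ \rank G = k.

(* Columns in [R^(k + d)] are pairs in [R^k * R^d]: [usubmx] and [dsubmx] are
   the components, and correspondingly [lsubmx A] is the block of the first [k]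
   columns of [A]. *)
Definition proj_last (R : realType) (k d : nat) (x : 'cV[R]_(k + d)) :
    'cV[R]_d := dsubmx x.

(* Main.v *)
Require Import Defs.
From mathcomp Require Import lra.

(** By Farkas' lemma, a linear form [c] attains its maximum over [P] exactly on
    [F] only if some multiple of it is a combination of the rows of [A_I] with
    positive weights. The image of [F] is a face of the image of [P] with
    preimage [F] iff such a [c] can be chosen to vanish on the fibres of the
    projection, that is, iff the rows of the first block of [A_I] are positively
    dependent. These rows have full rank iff the projection is injective on the
    affine hull of [F]; then [F] is affinely isomorphic to its image. If they do
    not, two points of [F] with the same image lie one in the relative interior
    of [F] and one in a proper face, so that faces of the image of [F] pull back
    injectively, but not onto, to the finitely many faces of [F], which
    contradicts combinatorial equivalence. *)

Set Implicit Arguments.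
Unset Strict Implicit.
Unset Printing Implicit Defensive.

Local Open Scope classical_set_scope.
Local Open Scope ring_scope.

(** * Farkas' lemma *)

(** Induction on the rows. If the vector [x] found for the other rows fails on the new row [a],
    everything is projected along [x] and the induction hypothesis is used once more. *)
Lemma farkas_cone (R : realFieldType) (m n : nat) (A : 'M[R]_(m, n))
    (c : 'rV[R]_n) :
  (exists2 l : 'rV[R]_m, forall i, 0 <= l 0 i & l *m A = c) \/
  (exists2 x : 'cV[R]_n, forall i, (A *m x) i 0 <= 0 & 0 < (c *m x) 0 0).
Proof.
elim: m A c => [A c|m IHm].
  have [->|c_neq0] := eqVneq c 0.
    by left; exists 0; [case | rewrite mul0mx].
  right; exists c^T; first by case.
  have sq_ge0 j : xpredT j -> 0 <= c 0 j * c^T j 0.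
    by rewrite mxE -expr2 sqr_ge0.
  rewrite mxE lt_def sumr_ge0 // andbT; apply: contra c_neq0 => /eqP c2_eq0.
  apply/eqP/rowP => j; rewrite mxE; apply/eqP.
  have /eqP := psumr_eq0P sq_ge0 c2_eq0 (i := j) isT.
  by rewrite mxE mulf_eq0 orbb.
rewrite -[m.+1]/(1 + m)%N => A c; rewrite -[A]vsubmxK.
move: (usubmx A) (dsubmx A) => a B {A}.
have coneS (t : R) (l : 'rV[R]_m) : 0 <= t -> (forall i, 0 <= l 0 i) ->
    t *: a + l *m B = c ->
    exists2 l : 'rV[R]_(1 + m), forall i, 0 <= l 0 i & l *m col_mx a B = c.
  move=> t_ge0 l_ge0 <-; exists (row_mx t%:M l).
    by move=> i; rewrite mxE; case: splitP => j _; rewrite ?mxE ?ord1 ?mulr1n.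
  by rewrite mul_row_col mul_scalar_mx.
have polarS (x : 'cV[R]_n) :
    (a *m x) 0 0 <= 0 -> (forall i, (B *m x) i 0 <= 0) ->
    forall i : 'I_(1 + m), (col_mx a B *m x) i 0 <= 0.
  by move=> ax Bx i; rewrite mul_col_mx mxE; case: splitP => j _;
    rewrite ?ord1.
have [[l l_ge0 lB]|[x Bx_le0 cx_gt0]] := IHm B c.
  by left; apply: (coneS 0 l); rewrite ?scale0r ?add0r.
have [ax_le0|ax_gt0] := lerP ((a *m x) 0 0) 0.
  by right; exists x => //; apply: polarS.
set s := (a *m x) 0 0 in ax_gt0.
(* Projection along [x] onto the hyperplane [a = 0]. *)
have mul_mx11 (t : 'M[R]_1) : t *m a = t 0 0 *: a.
  by rewrite {1}[t]mx11_scalar mul_scalar_mx.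
pose Q : 'M[R]_n := 1%:M - s^-1 *: (x *m a).
have mulQ p (M : 'M[R]_(p, n)) : M *m Q = M - s^-1 *: (M *m x *m a).
  by rewrite mulmxBr mulmx1 -scalemxAr mulmxA.
have aQ : a *m Q = 0.
  by rewrite mulQ mul_mx11 scalerA mulVf ?gt_eqF // scale1r subrr.
have [[l l_ge0 lB]|[y By_le0 cy_gt0]] := IHm (B *m Q) (c *m Q).
  (* Expanding the equality of the projected forms leaves this coefficient on [a]; it is nonnegative
     since [c] is positive and [B] nonpositive at [x]. *)
  left; apply: (coneS (s^-1 * ((c *m x) 0 0 - (l *m (B *m x)) 0 0)) l) => //.
    apply: mulr_ge0; first by rewrite invr_ge0 ltW.
    rewrite subr_ge0 (le_trans _ (ltW cx_gt0)) // mxE sumr_le0 // => j _.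
    by rewrite mulr_ge0_le0.
  move: lB; rewrite mulmxA !mulQ.
  rewrite !mul_mx11 !scalerA => /(canRL (subrK _)) lB.
  rewrite [l *m (B *m x)]mulmxA mulrBr scalerBl {2}lB.
  by rewrite addrC addrA [V in V - _]addrAC addrNK addrK.
right; exists (Q *m y); last by rewrite mulmxA.
by apply: polarS; rewrite !mulmxA // aQ mul0mx mxE.
Qed.

Lemma mulmx_lineE (R : comNzRingType) (m n : nat) (A : 'M[R]_(m, n))
    (x u : 'cV[R]_n) (t : R) (i : 'I_m) :
  (A *m (x + t *: u)) i 0 = (A *m x) i 0 + t * (A *m u) i 0.
Proof. by rewrite mulmxDr -scalemxAr !mxE. Qed.

(** Homogenization: the cone version is applied to the rows [(A | b)] and [(0 | 1)], the last weight
    being the gap [c0 - l b]. In the other alternative, [(z, t)] gives a ray along which [c] is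
    unbounded if [t = 0], and a point [z / - t] beyond [c0] if [t < 0]. *)
Lemma farkas_affine (R : realType) (m n : nat) (A : 'M[R]_(m, n))
    (b : 'cV[R]_m) (c : 'rV[R]_n) (c0 : R) :
  polyhedron A b !=set0 ->
  (forall x, polyhedron A b x -> (c *m x) 0 0 <= c0) ->
  exists l : 'rV[R]_m,
    [/\ forall i, 0 <= l 0 i, l *m A = c & (l *m b) 0 0 <= c0].
Proof.
move=> [x0 Px0] c_valid.
have [[l l_ge0]|[x Ax_le0 cx_gt0]] := farkas_cone
    (col_mx (row_mx A b) (row_mx 0 1%:M)) (row_mx c c0%:M).
  rewrite -[l]hsubmxK mul_row_col !mul_mx_row mulmx0 add_row_mx addr0 mulmx1.
  move=> /eq_row_mx[lA lb]; exists (lsubmx l); split=> //.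
    by move=> i; rewrite mxE.
  have /matrixP/(_ 0 0) := lb; rewrite !mxE mulr1n => <-.
  by rewrite ler_wpDr.
exfalso; pose z := usubmx x; pose t := dsubmx x 0 0.
have xE : x = col_mx z t%:M by rewrite -mx11_scalar vsubmxK.
have Az i : (A *m z) i 0 + t * b i 0 <= 0.
  have := Ax_le0 (lshift _ i).
  by rewrite xE mul_col_mx col_mxEu mul_row_col mul_mx_scalar !mxE.
have t_le0 : t <= 0.
  have := Ax_le0 (rshift _ 0).
  by rewrite xE mul_col_mx col_mxEd mul_row_col mul0mx mul1mx add0r mxE mulr1n.
have {cx_gt0} cz : 0 < (c *m z) 0 0 + c0 * t.
  by move: cx_gt0; rewrite xE mul_row_col -scalar_mxM !mxE mulr1n.
move: t_le0; rewrite le_eqVlt => /orP[/eqP t0|t_lt0].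
  rewrite t0 mulr0 addr0 in cz.
  (* Chosen so that [c] takes the value [c0 + 1] at [x0 + s *: z]. *)
  pose s := (c0 - (c *m x0) 0 0 + 1) / (c *m z) 0 0.
  have s_ge0 : 0 <= s.
    by rewrite divr_ge0 ?(ltW cz) // addr_ge0 // subr_ge0 c_valid.
  have /c_valid : polyhedron A b (x0 + s *: z).
    move=> i; have := Az i; rewrite mulmx_lineE t0 mul0r addr0 => Azi.
    by rewrite (le_trans _ (Px0 i)) // gerDl mulr_ge0_le0.
  rewrite mulmx_lineE divfK ?gt_eqF //; lra.
have Nt_gt0 : 0 < - t by rewrite oppr_gt0.
have /c_valid : polyhedron A b ((- t)^-1 *: z).
  move=> i; rewrite -scalemxAr mxE ler_pdivrMl //.
  by have := Az i; rewrite mulNr; lra.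
by rewrite -scalemxAr mxE ler_pdivrMl // mulNr; lra.
Qed.

(** * Tight inequalities and faces of a polyhedron *)

Lemma eq_setP (R : realType) (m n : nat) (A : 'M[R]_(m, n)) (b : 'cV[R]_m)
    (F : set 'cV[R]_n) (i : 'I_m) :
  reflect (forall x, F x -> (A *m x) i 0 = b i 0) (i \in eq_set A b F).
Proof. by rewrite inE; apply: asboolP. Qed.

Lemma slack_ge0 (R : realType) (m n : nat) (A : 'M[R]_(m, n)) (b : 'cV[R]_m)
    (l : 'rV[R]_m) (x : 'cV[R]_n) :
  (forall i, 0 <= l 0 i) -> polyhedron A b x ->
  forall i, 0 <= l 0 i * (b i 0 - (A *m x) i 0).
Proof. by move=> l_ge0 Px i; rewrite mulr_ge0 // subr_ge0. Qed.

Lemma sum_slack (R : realType) (m n : nat) (A : 'M[R]_(m, n)) (b : 'cV[R]_m)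
    (l : 'rV[R]_m) (x : 'cV[R]_n) :
  (l *m b) 0 0 - (l *m A *m x) 0 0 =
  \sum_i l 0 i * (b i 0 - (A *m x) i 0).
Proof.
rewrite -mulmxA !mxE -sumrB; apply: eq_bigr => i _.
by rewrite -mulrBr.
Qed.

Lemma dual_le (R : realType) (m n : nat) (A : 'M[R]_(m, n)) (b : 'cV[R]_m)
    (l : 'rV[R]_m) (x : 'cV[R]_n) :
  (forall i, 0 <= l 0 i) -> polyhedron A b x ->
  (l *m A *m x) 0 0 <= (l *m b) 0 0.
Proof.
move=> l_ge0 Px; rewrite -subr_ge0 sum_slack sumr_ge0 // => i _.
exact: slack_ge0.
Qed.

Lemma complementary_slackness (R : realType) (m n : nat) (A : 'M[R]_(m, n))
    (b : 'cV[R]_m) (l : 'rV[R]_m) (x : 'cV[R]_n) :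
  (forall i, 0 <= l 0 i) -> polyhedron A b x ->
  (l *m b) 0 0 <= (l *m A *m x) 0 0 ->
  forall i, l 0 i != 0 -> (A *m x) i 0 = b i 0.
Proof.
move=> l_ge0 Px lb_le i li_neq0.
have /(psumr_eq0P (fun i _ => slack_ge0 l_ge0 Px i)) slack0 :
    \sum_i l 0 i * (b i 0 - (A *m x) i 0) = 0.
  by rewrite -sum_slack; apply/eqP; rewrite subr_eq0 eq_le lb_le dual_le.
have /eqP := slack0 i isT; rewrite mulf_eq0 (negPf li_neq0) subr_eq0 /=.
by move/eqP.
Qed.

(** Farkas writes the normal of [F] as [l *m A], and complementary slackness on [F] confines the
    support of [l] to the tight indices. A point of the polyhedron tight there thus reaches [c0]. *)
Lemma face_eq_setE (R : realType) (m n : nat) (A : 'M[R]_(m, n))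
    (b : 'cV[R]_m) (F : set 'cV[R]_n) :
  is_face (polyhedron A b) F -> F !=set0 ->
  F = polyhedron A b `&`
      [set x | forall i, i \in eq_set A b F -> (A *m x) i 0 = b i 0].
Proof.
move=> [c [c0 [c_valid FE]]] [x0 Fx0]; apply/seteqP; split=> x.
  move=> Fx; split; first by move: Fx; rewrite FE => -[].
  by move=> i /eq_setP/(_ _ Fx).
case=> Px x_tight; rewrite FE; split=> //=.
have [Px0 cx0] : polyhedron A b x0 /\ (c *m x0) 0 0 = c0.
  by move: Fx0; rewrite FE.
have [l [l_ge0 lA lb]] := farkas_affine (ex_intro _ x0 Px0) c_valid.
have /eqP := sum_slack A b l x; rewrite big1 ?subr_eq0.
  move/eqP; rewrite lA => <-; apply/eqP; rewrite eq_le lb -cx0 -lA.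
  exact: dual_le.
move=> i _; have [->|li_neq0] := eqVneq (l 0 i) 0; first by rewrite mul0r.
rewrite x_tight ?subrr ?mulr0 //; apply/eq_setP => y.
rewrite FE => -[Py cy]; apply: complementary_slackness li_neq0 => //.
by rewrite lA cy.
Qed.

(** Makes results on polyhedra available for a face. *)
Lemma face_polyhedronE (R : realType) (m n : nat) (A : 'M[R]_(m, n))
    (b : 'cV[R]_m) (c : 'rV[R]_n) (c0 : R) :
  (forall x, polyhedron A b x -> (c *m x) 0 0 <= c0) ->
  polyhedron A b `&` [set x | (c *m x) 0 0 = c0] =
  polyhedron (col_mx A (- c)) (col_mx b (- c0%:M)).
Proof.
move=> c_valid; apply/seteqP; split=> x /=.
  move=> [Px cx] i; rewrite mul_col_mx !mxE; case: splitP => j _ //.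
  by rewrite mulNmx !mxE !ord1 -cx mulr1n mxE.
move=> Px; have Px' : polyhedron A b x.
  by move=> i; have := Px (lshift _ i); rewrite mul_col_mx !col_mxEu.
split=> //; apply/eqP; rewrite eq_le c_valid //=.
have := Px (rshift _ 0); rewrite mul_col_mx !col_mxEd mulNmx !mxE lerN2.
by rewrite mulr1n.
Qed.

(* For every [i] tight on [F], Farkas for [- A i x <= - b i] on [F] gives a
   multiple of [c] in which row [i] has a positive weight; these are added up.
   The multiple may be [0]. *)
Lemma face_normal_gt0 (R : realType) (m n : nat) (A : 'M[R]_(m, n))
    (b : 'cV[R]_m) (F : set 'cV[R]_n) (c : 'rV[R]_n) (c0 : R) :
  (forall x, polyhedron A b x -> (c *m x) 0 0 <= c0) ->
  F = polyhedron A b `&` [set x | (c *m x) 0 0 = c0] -> F !=set0 ->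
  exists (mu : R) (l : 'rV[R]_m),
    [/\ forall i, i \in eq_set A b F -> 0 < l 0 i,
        forall i, i \notin eq_set A b F -> l 0 i = 0 & l *m A = mu *: c].
Proof.
move=> c_valid FE F_neq0.
have /choice[p pP] i : exists p : R * 'rV[R]_m,
    [/\ forall j, 0 <= p.2 0 j, i \in eq_set A b F -> 0 < p.2 0 i,
        p.2 *m A = p.1 *: c & (p.2 *m b) 0 0 <= p.1 * c0].
  have [/eq_setP Fi|] := boolP (i \in eq_set A b F); last first.
    exists (0, 0); split=> //=; first by move=> j; rewrite mxE.
      by rewrite mul0mx scale0r.
    by rewrite mul0mx mxE mul0r.
  rewrite (face_polyhedronE c_valid) in FE; rewrite FE in F_neq0.
  have [] := @farkas_affine _ _ _ _ _ (- row i A) (- b i 0) F_neq0.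
    move=> x; rewrite -FE => /Fi Aix.
    by rewrite mulNmx -row_mul !mxE lerN2 -Aix mxE.
  move=> l; rewrite -[l]hsubmxK; set k := lsubmx l; set t := rsubmx l 0 0.
  rewrite [rsubmx l]mx11_scalar -/t !mul_row_col !mul_scalar_mx.
  move=> [kt_ge0 kA kb].
  have k_ge0 j : 0 <= k 0 j by have := kt_ge0 (lshift _ j); rewrite row_mxEl.
  (* Farkas gave [k *m A - t *: c = - row i A]; one more unit of row [i] turns this into a
     combination equal to [t *: c]. *)
  exists (t, k + delta_mx 0 i); split=> /=.
  - by move=> j; rewrite mxE addr_ge0 // mxE ler0n.
  - by move=> _; rewrite mxE ltr_wpDl // mxE !eqxx.
  - rewrite mulmxDl -rowE -[row i A]opprK -kA opprD addNKr.
    by rewrite scalerN opprK.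
  - move: kb; rewrite mulmxDl -rowE !mxE mulr1n; lra.
have p_sum_ge0 j : 0 <= (\sum_i (p i).2) 0 j.
  by rewrite summxE sumr_ge0 // => i _; case: (pP i).
have lA : (\sum_i (p i).2) *m A = (\sum_i (p i).1) *: c.
  rewrite mulmx_suml scaler_suml; apply: eq_bigr => i _.
  by case: (pP i).
exists (\sum_i (p i).1), (\sum_i (p i).2); split=> // i.
  move=> Fi; rewrite summxE (bigD1 i) //= ltr_pwDl //.
    by case: (pP i) => _ ->.
  by rewrite sumr_ge0 // => j _; case: (pP j).
apply: contraNeq => li_neq0; apply/eq_setP => x.
rewrite FE => -[Px cx]; apply: complementary_slackness li_neq0 => //.
rewrite lA -scalemxAl [leRHS]mxE cx mulmx_suml summxE mulr_suml.
by apply: ler_sum => j _; case: (pP j).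
Qed.

(** Each [y i] is strict at [i] unless [i] is tight on all of [F]; the average of [x0] and the [y i]
    is strict at all these indices at once. *)
Lemma face_relint (R : realType) (m n : nat) (A : 'M[R]_(m, n))
    (b : 'cV[R]_m) (F : set 'cV[R]_n) :
  is_face (polyhedron A b) F -> F !=set0 ->
  exists2 x, F x & forall i, i \notin eq_set A b F -> (A *m x) i 0 < b i 0.
Proof.
move=> face_F F_neq0; have FE := face_eq_setE face_F F_neq0.
have [x0 Fx0] := F_neq0.
have FP x : F x -> polyhedron A b x by rewrite FE => -[].
have /choice[y yP] i : exists y,
    F y /\ (i \notin eq_set A b F -> (A *m y) i 0 < b i 0).
  have [Fi|/eq_setP Fi] := boolP (i \in eq_set A b F); first by exists x0.
  move/existsNP: Fi => [y /not_implyP[Fy /eqP Aiy]].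
  by exists y; split=> // _; rewrite lt_neqAle Aiy FP.
have m1_gt0 : 0 < m.+1%:R :> R by rewrite ltr0n.
have m1_bE i : m.+1%:R * b i 0 = b i 0 + \sum_(j < m) b i 0.
  by rewrite sumr_const card_ord -mulrS mulr_natl.
pose x := m.+1%:R^-1 *: (x0 + \sum_i y i).
have AxE i : (A *m x) i 0 =
    m.+1%:R^-1 * ((A *m x0) i 0 + \sum_j (A *m y j) i 0).
  by rewrite -scalemxAr mulmxDr mulmx_sumr -summxE !mxE.
exists x.
  rewrite FE; split=> [i|i /eq_setP Fi].
    rewrite AxE ler_pdivrMl // m1_bE lerD ?FP // ler_sum // => j _.
    by apply: FP; case: (yP j).
  rewrite AxE Fi // (eq_bigr (fun=> b i 0)) => [|j _]; last first.
    by apply: Fi; case: (yP j).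
  by rewrite -m1_bE mulKf ?gt_eqF.
move=> i NFi; rewrite AxE ltr_pdivrMl // m1_bE ler_ltD ?FP //.
rewrite (bigD1 i) //= [ltRHS](bigD1 i) //= ltr_leD ?(yP i).2 //.
by rewrite ler_sum // => j _; apply: FP; case: (yP j).
Qed.

(** * Boundedness, and finiteness of the set of faces *)

(** Boundedness forces some row to grow along [u]; the least ratio [tt i] over the growing rows is
    the exit time. *)
Lemma bounded_exit (R : realType) (m n : nat) (A : 'M[R]_(m, n))
    (b : 'cV[R]_m) (x u : 'cV[R]_n) :
  bounded_set (polyhedron A b) -> polyhedron A b x -> u != 0 ->
  exists (t : R) (i : 'I_m),
    [/\ polyhedron A b (x + t *: u), 0 < (A *m u) i 0 &
        (A *m (x + t *: u)) i 0 = b i 0].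
Proof.
move=> bnd Px u_neq0.
have [i0 Aui0] : exists i, 0 < (A *m u) i 0.
  apply: contrapT => /forallNP Au_le0.
  have ray t : 0 <= t -> polyhedron A b (x + t *: u).
    move=> t_ge0 i; rewrite mulmx_lineE (le_trans _ (Px i)) //.
    by rewrite gerDl mulr_ge0_le0 // leNgt; apply/negP/Au_le0.
  have [M PM] := (ex_bound _ (PF := globally_properfilter Px)).1 bnd.
  have M_ge0 : 0 <= M by rewrite (le_trans _ (PM _ Px)).
  have u_gt0 : 0 < `|u| by rewrite normr_gt0.
  (* Makes the norm of [t *: u] exceed [M + |x|]. *)
  pose t := (M + `|x| + 1) / `|u|.
  have t_ge0 : 0 <= t by rewrite divr_ge0 // !addr_ge0.
  have := ler_normB (x + t *: u) x; rewrite [x + _]addrC addrK normrZ.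
  rewrite ger0_norm // divfK ?gt_eqF // [t *: u + x]addrC.
  have := PM _ (ray t t_ge0); rewrite /=; lra.
pose tt i := (b i 0 - (A *m x) i 0) / (A *m u) i 0.
case: (@arg_minP _ _ _ i0 (fun i => 0 < (A *m u) i 0) tt Aui0) => i Aui tt_min.
have ttE j : 0 < (A *m u) j 0 -> (A *m x) j 0 + tt j * (A *m u) j 0 = b j 0.
  by move=> Auj; rewrite divfK ?gt_eqF // addrC subrK.
exists (tt i), i; split=> //; last by rewrite mulmx_lineE ttE.
have tt_ge0 : 0 <= tt i by rewrite divr_ge0 ?(ltW Aui) // subr_ge0.
move=> j; rewrite mulmx_lineE; have [Auj|Auj] := ltP 0 ((A *m u) j 0).
  by rewrite -[leRHS](ttE _ Auj) lerD2l ler_pM2r // tt_min.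
by rewrite (le_trans _ (Px j)) // gerDl mulr_ge0_le0.
Qed.

(** Pigeonhole on the orbit of [s]: two iterates of [h] agree, and cancelling [h] shows that [s]
    itself recurs. *)
Lemma finite_inj_surj (T : Type) (U : finType) (S : set T) (e : T -> U)
    (h : T -> T) :
  (forall s, S s -> S (h s)) ->
  (forall s t, S s -> S t -> e s = e t -> s = t) ->
  (forall s t, S s -> S t -> h s = h t -> s = t) ->
  forall s, S s -> exists2 t, S t & h t = s.
Proof.
move=> hS e_inj h_inj s Ss.
have itS i : S (iter i h s) by elim: i => //= i /hS.
have [/injectiveP/leq_card|/injectivePn[i [j]]] :=
    boolP (injectiveb (fun i : 'I_#|U|.+1 => e (iter i h s))).
  by rewrite card_ord ltnn.
wlog ij : i j / (i < j)%N => [wlg ij /esym eij|_ /(e_inj _ _ (itS _) (itS _))].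
  move: (ij); rewrite neq_ltn => /orP[lt|lt]; first exact: wlg lt ij (esym eij).
  by apply: wlg lt _ eij; rewrite eq_sym.
elim: (i : nat) (j : nat) ij => [|i' IHi] [|j'] //= lt_ij.
  by exists (iter j' h s).
by move/(h_inj _ _ (itS _) (itS _)); apply: IHi.
Qed.

Lemma face_inj_surj (R : realType) (m n : nat) (A : 'M[R]_(m, n))
    (b : 'cV[R]_m) (h : set 'cV[R]_n -> set 'cV[R]_n) :
  let face := is_face (polyhedron A b) in
  (forall H, face H -> face (h H)) ->
  (forall H H', face H -> face H' -> h H = h H' -> H = H') ->
  forall H, face H -> exists2 H', face H' & h H' = H.
Proof.
move=> face h_face h_inj.
(* Tight indices determine a face only among nonempty ones; the boolean singles out the empty
   face. *)
apply: (@finite_inj_surj _ (bool * {set 'I_m})%type face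
  (fun H => (H == set0, eq_set A b H)) h h_face _ h_inj).
move=> H H' face_H face_H' /pair_equal_spec[eq0E eq_setE].
have [H_eq0|H_neq0] := eqVneq H set0.
  by apply/esym/eqP; rewrite H_eq0 -eq0E; apply/eqP.
have /set0P H'_neq0 : H' != set0 by rewrite -eq0E.
move/set0P: H_neq0 => H_neq0.
by rewrite (face_eq_setE face_H H_neq0) (face_eq_setE face_H' H'_neq0) eq_setE.
Qed.

(** * Faces and the projection *)

Lemma mul_row0_proj (R : realType) (k d : nat) (c : 'rV[R]_d)
    (x : 'cV[R]_(k + d)) :
  row_mx 0 c *m x = c *m proj_last x.
Proof. by rewrite -[x in LHS]vsubmxK mul_row_col mul0mx add0r. Qed.

Lemma face_proj_preimage (R : realType) (k d : nat) (F : set 'cV[R]_(k + d))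
    (G : set 'cV[R]_d) :
  is_face (@proj_last R k d @` F) G ->
  is_face F (F `&` @proj_last R k d @^-1` G).
Proof.
move=> [c [c0 [c_valid ->]]]; exists (row_mx 0 c), c0; split.
  by move=> x Fx; rewrite mul_row0_proj; apply: c_valid; exists x.
apply/seteqP; split=> x /=; rewrite mul_row0_proj.
  by move=> [Fx [_ cx]].
by move=> [Fx cx]; split=> //; split=> //; exists x.
Qed.

Lemma proj_image_preimage (R : realType) (k d : nat) (F : set 'cV[R]_(k + d))
    (G : set 'cV[R]_d) :
  G `<=` @proj_last R k d @` F ->
  @proj_last R k d @` (F `&` @proj_last R k d @^-1` G) = G.
Proof.
move=> GF; apply/seteqP; split=> [_ [x [_ Gx] <-] //|y Gy].
by have [x Fx xy] := GF _ Gy; exists x => //; split=> //=; rewrite xy.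
Qed.

Lemma face_sub (R : realType) (n : nat) (P F : set 'cV[R]_n) :
  is_face P F -> F `<=` P.
Proof. by move=> [c [c0 [_ ->]]] x []. Qed.

(** On a graph the projection is injective, and substituting for the first block turns a linear form
    into an affine function of the last [d] coordinates. Faces then correspond by image and
    preimage. *)
Lemma comb_equivalent_graph (R : realType) (k d : nat)
    (F : set 'cV[R]_(k + d)) (v : 'cV[R]_k) (N : 'M[R]_(k, d)) :
  (forall x, F x -> usubmx x = v + N *m dsubmx x) ->
  comb_equivalent (@proj_last R k d @` F) F.
Proof.
move=> graphF.
exists (fun G => F `&` @proj_last R k d @^-1` G), (image^~ (@proj_last R k d)).
have projF_inj x y : F x -> F y -> proj_last x = proj_last y -> x = y.
  rewrite /proj_last => Fx Fy xy.
  by rewrite -[x]vsubmxK -[y]vsubmxK !graphF // xy.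
split=> [G face_G|H face_H|G H face_G face_H].
- split; first exact: face_proj_preimage.
  by apply: proj_image_preimage; apply: face_sub.
- have HF := face_sub face_H; split; last first.
    apply/seteqP; split=> [x [Fx [y Hy /projF_inj <-]]|x Hx] //.
      exact: HF.
    by split; [apply: HF | exists x].
  have [c [c0 [c_valid HE]]] := face_H.
  have cE x : F x -> (c *m x) 0 0 = (lsubmx c *m v) 0 0 +
      ((rsubmx c + lsubmx c *m N) *m proj_last x) 0 0.
    move=> Fx; rewrite -[c in LHS]hsubmxK -[x in LHS]vsubmxK mul_row_col.
    rewrite graphF // mulmxDl mulmxDr mulmxA -addrA [X in _ + X]addrC mxE.
    by congr (_ + _).
  exists (rsubmx c + lsubmx c *m N), (c0 - (lsubmx c *m v) 0 0); split.
    by move=> _ [x Fx <-]; rewrite lerBrDl -cE // c_valid.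
  apply/seteqP; split=> [_ [x Hx <-]|_ [[x Fx <-] /= cx]].
    have Fx := HF _ Hx; split; first by exists x.
    by move: Hx; rewrite HE /= => -[_ <-]; rewrite cE // addrAC subrr add0r.
  by exists x => //; rewrite HE; split=> //=; rewrite cE // cx addrC subrK.
- split=> [FGH y Gy|GH x [Fx Gx]]; last by split=> //; apply: GH.
  have [x Fx xy] := face_sub face_G Gy.
  by rewrite -xy; apply: (FGH x _).2; split=> //=; rewrite xy.
Qed.

(** * Sufficiency of positive spanning *)

Lemma row_submxE (R : realType) (m n : nat) (A : 'M[R]_(m, n)) (I : {set 'I_m})
    (x : 'cV[R]_n) (j : 'I_#|I|) :
  (row_submx A I *m x) j 0 = (A *m x) (enum_val j) 0.
Proof. by rewrite mul_rowsub_mx mxE. Qed.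

Lemma row_submx_block (R : realType) (m k d : nat) (A : 'M[R]_(m, k + d))
    (I : {set 'I_m}) :
  row_submx A I = row_mx (row_submx (lsubmx A) I) (row_submx (rsubmx A) I).
Proof.
by apply/matrixP => i j; rewrite -{1}[A]hsubmxK !mxE; case: splitP => j' _;
  rewrite !mxE.
Qed.

(** Weighting the tight rows by [l] cancels the first block, leaving a form [c] on the image; it is
    maximal exactly on [F] as all weights are positive. Full rank lets the tight equations be solved
    for the first block, so [F] is a graph. *)
Lemma strictly_preserved_of_positively_spanning (R : realType) (m k d : nat)
    (A : 'M[R]_(m, k + d)) (b : 'cV[R]_m) (F : set 'cV[R]_(k + d)) :
  is_face (polyhedron A b) F -> F !=set0 ->
  positively_spanning (row_submx (lsubmx A) (eq_set A b F)) ->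
  strictly_preserved (@proj_last R k d) (polyhedron A b) F.
Proof.
move=> face_F F_neq0; set I := eq_set A b F; set G := row_submx _ _.
move=> [[l [l_gt0 lG]] rankG].
have FP := face_sub face_F; have FE := face_eq_setE face_F F_neq0.
have tight x : F x -> row_submx A I *m x = row_submx b I.
  move=> Fx; apply/colP => j; rewrite row_submxE [RHS]mxE.
  by have /eq_setP-> := enum_valP j.
pose L : 'rV_#|I| := \row_j l j.
pose c := L *m row_submx (rsubmx A) I; pose c0 := (L *m row_submx b I) 0 0.
have cE x : c *m proj_last x = L *m row_submx A I *m x.
  rewrite -mul_row0_proj row_submx_block mul_mx_row -/G.
  suff -> : L *m G = 0 by [].
  by rewrite mulmx_sum_row -[RHS]lG; apply: eq_bigr => j _; rewrite mxE.
have L_ge0 j : 0 <= L 0 j by rewrite mxE ltW.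
have PI x : polyhedron A b x -> polyhedron (row_submx A I) (row_submx b I) x.
  by move=> Px j; rewrite row_submxE [leRHS]mxE.
have c_le x : polyhedron A b x -> (c *m proj_last x) 0 0 <= c0.
  by move=> /PI Px; rewrite cE dual_le.
have c_eq x : polyhedron A b x -> (c *m proj_last x) 0 0 = c0 -> F x.
  move=> Px cx; rewrite FE; split=> // i Ii.
  have lb_le : (L *m row_submx b I) 0 0 <= (L *m row_submx A I *m x) 0 0.
    by rewrite -cE cx.
  have := complementary_slackness L_ge0 (PI _ Px) lb_le
    (i := enum_rank_in Ii i).
  rewrite row_submxE [row_submx b I _ _]mxE enum_rankK_in //; apply.
  by rewrite mxE gt_eqF.
have c_F x : F x -> (c *m proj_last x) 0 0 = c0.
  by move=> Fx; rewrite cE -mulmxA tight.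
split.
- exists c, c0; split; first by move=> _ [x Px <-]; apply: c_le.
  apply/seteqP; split=> [_ [x Fx <-]|_ [[x Px <-] /= cx]].
    by split; [exists x => //; apply: FP | apply: c_F].
  by exists x => //; apply: c_eq.
- have /row_fullP[M MG] : row_full G by rewrite /row_full rankG.
  apply: (@comb_equivalent_graph _ _ _ _
    (M *m row_submx b I) (- (M *m row_submx (rsubmx A) I))).
  move=> x Fx; have := tight x Fx.
  rewrite row_submx_block -/G -[x in LHS]vsubmxK mul_row_col => <-.
  by rewrite mulmxDr !mulmxA MG mul1mx mulNmx addrK.
- apply/seteqP; split=> [x [Px [y Fy yx]]|x Fx].
    by apply: c_eq => //; rewrite -yx c_F.
  by split; [apply: FP | exists x].
Qed.

(** * Necessity of positive spanning *)

Lemma strictly_preserved_rank (R : realType) (m k d : nat)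
    (A : 'M[R]_(m, k + d)) (b : 'cV[R]_m) (F : set 'cV[R]_(k + d)) :
  bounded_set (polyhedron A b) -> is_face (polyhedron A b) F -> F !=set0 ->
  comb_equivalent (@proj_last R k d @` F) F ->
  \rank (row_submx (lsubmx A) (eq_set A b F)) = k.
Proof.
move=> bnd face_F F_neq0 [f [g [_ fg _]]].
have FP := face_sub face_F; have FE := face_eq_setE face_F F_neq0.
set G := row_submx _ _; apply/eqP; apply: contraT => rank_neq.
have [u u_neq0 Gu] : exists2 u : 'cV_k, u != 0 & G *m u = 0.
  have : kermx G^T != 0 by rewrite kermx_eq0 /row_free mxrank_tr.
  case/rowV0Pn => w /sub_kermxP wG w_neq0; exists w^T.
    by rewrite trmx_eq0.
  by apply: trmx_inj; rewrite trmx_mul trmxK wG trmx0.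
(* A direction inside the fibres along which the rows tight on [F] stay constant. *)
pose w : 'cV[R]_(k + d) := col_mx u 0.
have w_neq0 : w != 0 by rewrite col_mx_eq0 eqxx andbT.
have Aw i : i \in eq_set A b F -> (A *m w) i 0 = 0.
  move=> Fi; have := row_submxE A w (enum_rank_in Fi i).
  rewrite enum_rankK_in // => <-.
  by rewrite row_submx_block mul_row_col Gu mulmx0 addr0 mxE.
have [x Fx x_relint] := face_relint face_F F_neq0.
have [t [i [Py Awi Ayi]]] := bounded_exit bnd (FP _ Fx) w_neq0.
set y := x + t *: w in Py Ayi.
have Fy : F y.
  rewrite FE; split=> // j Fj; rewrite mulmx_lineE Aw // mulr0 addr0.
  exact: (eq_setP _ _ _ _ Fj).
have xy : proj_last x = proj_last y.
  by rewrite /proj_last linearD linearZ /= col_mxKd scaler0 addr0.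
have NFi : i \notin eq_set A b F.
  by apply/negP => /Aw Awi0; rewrite Awi0 ltxx in Awi.
(* This face contains [y] but not [x], although both have the same image. *)
pose H := F `&` [set z | (row i A *m z) 0 0 = b i 0].
have face_H : is_face F H.
  exists (row i A), (b i 0); split=> // z /FP Pz.
  by rewrite -row_mul mxE.
have HxP z : F z -> H z <-> (A *m z) i 0 = b i 0.
  by move=> Fz; rewrite /H /= -row_mul mxE; split=> [[]|].
have gF H' : is_face F H' -> g H' `<=` @proj_last R k d @` F.
  by move=> /fg[/face_sub].
(* [f] undoes [g] and taking images undoes taking preimages, so [h] is injective on the faces of
   [F]; by finiteness it reaches [H]. *)
pose h H' := F `&` @proj_last R k d @^-1` (g H').
have [H' face_H' H'E] : exists2 H', is_face F H' & h H' = H.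
  have [c [c0 [c_valid]]] := face_F; rewrite (face_polyhedronE c_valid) => FE'.
  move: face_H; rewrite {1 2}FE' => face_H; apply: face_inj_surj face_H.
    move=> H' face_H'; rewrite -FE' in face_H'; rewrite -FE' /h.
    by apply: face_proj_preimage; case: (fg _ face_H').
  move=> H1 H2; rewrite -FE' => face_H1 face_H2 h12.
  rewrite -(fg _ face_H1).2 -(fg _ face_H2).2.
  rewrite -(proj_image_preimage (gF _ face_H1)) -/(h H1) h12.
  by rewrite proj_image_preimage //; apply: gF.
have : H y by apply/HxP.
rewrite -H'E => -[_ gH'y].
(* A preimage under the projection cannot separate [x] from [y]. *)
have : H x by rewrite -H'E; split=> //; rewrite /preimage /= xy.
by move/(HxP _ Fx).1 => Axi; have := x_relint _ NFi; rewrite Axi ltxx.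
Qed.

Theorem lemma2p5 (R : realType) (m k d : nat)
    (A : 'M[R]_(m, k + d)) (b : 'cV[R]_m) (F : set 'cV[R]_(k + d))
    (bounded_P : bounded_set (polyhedron A b))
    (fulldim_P : full_dimensional (polyhedron A b))
    (irred_Ab : irredundant A b)
    (face_F : is_face (polyhedron A b) F)
    (F_neq0 : F !=set0) :
  strictly_preserved (@proj_last R k d) (polyhedron A b) F <->
  positively_spanning (row_submx (lsubmx A) (eq_set A b F)).
Proof.
split; last exact: strictly_preserved_of_positively_spanning.
move=> [[c [c0 [c_valid piFE]]] comb_F piF].
split; last exact: strictly_preserved_rank.
have c'_valid x : polyhedron A b x -> (row_mx 0 c *m x) 0 0 <= c0.
  by move=> Px; rewrite mul_row0_proj; apply: c_valid; exists x.
(* As [F] is the full preimage of its image, the normal of the image face pulls back to a normal of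
   [F] with zero first block. *)
have FE : F = polyhedron A b `&` [set x | (row_mx 0 c *m x) 0 0 = c0].
  rewrite -piF piFE; apply/seteqP; split=> x /=; rewrite mul_row0_proj.
    by move=> [Px [_ cx]].
  by move=> [Px cx]; split=> //; split=> //; exists x.
have [mu [l [l_gt0 l_eq0 lA]]] := face_normal_gt0 c'_valid FE F_neq0.
exists (fun j => l 0 (enum_val j)); split.
  by move=> j; rewrite l_gt0 ?enum_valP.
under eq_bigr do rewrite row_rowsub.
rewrite -(big_enum_val (fun i => l 0 i *: row i (lsubmx A))) /=.
(* The first block of [mu *: row_mx 0 c] is zero for every [mu], so [mu = 0] does no harm. *)
have lA0 : l *m lsubmx A = 0.
  by rewrite mulmx_lsub lA scale_row_mx scaler0 row_mxKl.
rewrite -[RHS]lA0 mulmx_sum_row [RHS](bigID (mem (eq_set A b F))) /=.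
rewrite [X in _ = _ + X]big1 ?addr0 // => i /l_eq0 ->.
by rewrite scale0r.
Qed.
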